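(* Let $n\ge1$ be an integer. The spectrum of $U_n$ on the set $\mathfrak{H}$ of hypergeometric functions, i.e. the set of all $\lambda\in\mathbb{C}$ for which there exists $f\in\mathfrak{H}$ with $U_nf=\lambda f$, is exactly $\{n^i: i\in\mathbb{Z}\}$.
   Context: For $n\ge1$ the operator $U_n$ acts on formal power series with complex coefficients by $U_n\left(\sum_{k\ge0}c_kx^k\right)=\sum_{k\ge0}c_{nk}x^k$. The ascending factorial is $(c)_k=c(c+1)\cdots(c+k-1)$, $(c)_0=1$. The set $\mathfrak{H}$ of hypergeometric functions consists of all series $$f(x)=a_0\,x^j\sum_{k=0}^\infty\frac{(a_1)_k\cdots(a_p)_k}{(b_1)_k\cdots(b_q)_k}\frac{x^k}{k!}$$ with integers $j,p,q\ge0$, constant $a_0\in\mathbb{C}\setminus\{0\}$, nonzero complex parameters $a_i,b_i$, no $b_i$ a nonpositive integer. Ratios of consecutive coefficients of the sum are required to be given by a rational function of $k$; in particular these coefficients are all nonzero, i.e. no $a_i$ ($i\ge1$) is a nonpositive integer. *)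

(* Defs.v *)
From HB Require Import structures.
From mathcomp Require Import all_boot all_order all_algebra.
From mathcomp Require Import all_classical all_reals.
From mathcomp Require Import complex.

Set Implicit Arguments.
Unset Strict Implicit.
Unset Printing Implicit Defensive.

Import Order.TTheory GRing.Theory Num.Theory.
Local Open Scope classical_set_scope.
Local Open Scope ring_scope.

(* A formal power series is identified with its sequence of coefficients. *)
Definition fps (C : Type) : Type := nat -> C.

Definition fps_scale (C : fieldType) (l : C) (f : fps C) : fps C :=
  fun k => l * f k.

(* Multiplication by x^j. *)
Definition fps_shift (C : fieldType) (j : nat) (f : fps C) : fps C :=
  fun k => if (k < j)%N then 0 else f (k - j)%N.

Definition U (C : fieldType) (n : nat) (f : fps C) : fps C :=
  fun k => f (n * k)%N.

Definition ascfact (C : fieldType) (c : C) (k : nat) : C :=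
  \prod_(i < k) (c + i%:R).

Definition nonpos_integer (C : fieldType) (c : C) : Prop :=
  exists m : nat, c = - m%:R.

(* The lists a and b hold the numerator parameters a_1, ..., a_p and the
   denominator parameters b_1, ..., b_q. *)
Definition hyp_series (C : fieldType) (a b : seq C) : fps C :=
  fun k => (\prod_(c <- a) ascfact c k) / (\prod_(c <- b) ascfact c k)
           / (k`!)%:R.

(* Excluding nonpositive integers among the numerator parameters as well keeps
   every coefficient of the sum nonzero, so terminating sums are ruled out. *)
Definition hypergeometric (C : fieldType) : set (fps C) :=
  [set f | exists (a0 : C) (j : nat) (a b : seq C),
     [/\ a0 != 0,
         forall c, c \in a -> c != 0 /\ ~ nonpos_integer c,
         forall c, c \in b -> c != 0 /\ ~ nonpos_integer c
       & f = fps_scale a0 (fps_shift j (hyp_series a b))]].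
Arguments hypergeometric C : clear implicits.

Definition spectrum (C : fieldType) (T : fps C -> fps C) (S : set (fps C)) :
    set C :=
  [set l | exists2 f, S f & T f = fps_scale l f].

(* Main.v *)
Require Import Defs.
From mathcomp Require Import all_boot all_order all_algebra.
From mathcomp Require Import all_classical all_reals.
From mathcomp Require Import complex.
From mathcomp Require Import zify ring.

(** The series [x * \sum_k (k+1)^i x^k], whose coefficient of [x^k] is [k^i],
    is hypergeometric because [k+1 = (2)_k / (1)_k], and [U_n] multiplies it by
    [n^i].  So every power of [n] is an eigenvalue.

    Conversely, let [U_n f = l f] with [f] hypergeometric and [n >= 2].  The
    coefficients of [f] are nonzero exactly from index [j] on, and comparing
    supports in [f(nk) = l f(k)] forces [j <= 1].  If [j = 0], then [k = 0]
    gives [l = 1].  If [j = 1], then for [k >= 1]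
    [f(k+1) / f(k) = P(k) / Q(k)], where [P] and [Q] are monic split
    polynomials with root lists [s] and [t].  The eigenvalue equation becomes
    the identity of rational functions
    [\prod_(i < n) (P/Q)(n x + i) = (P/Q)(x)], so the divisor
    [D = s - t] of [P/Q] satisfies [D(z) = \sum_(i < n) D(n z + i)]
    ([perm_fold_roots]).

    Write [D(z) = G(z+1) - G(z)] with [G] vanishing far to the left:
    [G] is the divisor of a quotient of reciprocal Gamma functions solving
    [H(x+1) = (P/Q)(x) H(x)] up to sign.  The equation for [D] telescopes
    to say that [G(n z) - G(z)] has period 1; it vanishes far to the left, so
    [G(n z) = G(z)] ([gamma_divisor_scale]).  If [G(z) <> 0] with [z <> 0], the
    infinitely many points [z / n^k] would lie in the support of [G], which is
    contained in finitely many half-lines [w + {1, 2, ...}] and thus has only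
    finitely many points in a bounded region ([gamma_divisor_eq0]).  Hence
    [G] is supported at 0, [P/Q = ((x+1)/x)^m] with [m = G(0)], so
    [f(k) = f(1) k^m] and [l = f(n) / f(1) = n^m] ([eigenvalue_is_power]). *)

Import Order.TTheory GRing.Theory Num.Theory.
Local Open Scope classical_set_scope.
Local Open Scope ring_scope.
Local Open Scope complex_scope.

(** * The divisor equation *)

Lemma poly_eq_on_posnat {F : numFieldType} (p q : {poly F}) :
  (forall k, (0 < k)%N -> p.[k%:R] = q.[k%:R]) -> p = q.
Proof.
move=> pq; apply/eqP; rewrite -subr_eq0; apply/eqP.
apply: (@roots_geq_poly_eq0 _ _ [seq k%:R | k <- iota 1 (size (p - q))]).
- apply/allP => x /mapP[k]; rewrite mem_iota => /andP[k_gt0 _] ->.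
  by rewrite /root hornerD hornerN pq// subrr.
- by rewrite map_inj_uniq ?iota_uniq// => i j /eqP; rewrite eqr_nat => /eqP.
- by rewrite size_map size_iota.
Qed.

(** The roots of [x |-> \prod_(i < n) P(n x + i)] when [s] lists the roots
    of [P]. *)
Definition fold_roots {F : fieldType} (n : nat) (s : seq F) : seq F :=
  [seq (w - i%:R) / n%:R | i <- iota 0 n, w <- s].

Lemma prod_fold_roots {F : numFieldType} (n : nat) (s : seq F) (x : F) :
  (0 < n)%N ->
  \prod_(i < n) \prod_(w <- s) (n%:R * x + i%:R - w) =
  n%:R ^+ (n * size s) * \prod_(w <- fold_roots n s) (x - w).
Proof.
move=> n_gt0; have n0 : n%:R != 0 :> F by rewrite pnatr_eq0 -lt0n.
have shiftE i : \prod_(w <- s) (n%:R * x + i%:R - w) =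
    n%:R ^+ size s * \prod_(w <- s) (x - (w - i%:R) / n%:R).
  elim: s => [|w r IH]; first by rewrite !big_nil mulr1.
  by rewrite !big_cons IH /= exprS mulrACA; congr (_ * _); field.
rewrite -(big_mkord xpredT (fun i => \prod_(w <- s) (n%:R * x + i%:R - w))).
rewrite /index_iota subn0 /fold_roots.
have -> : (n * size s = size s * size (iota 0 n))%N.
  by rewrite size_iota mulnC.
rewrite exprM.
elim: (iota 0 n) => [|i r IH]; first by rewrite !big_nil mulr1.
by rewrite big_cons IH shiftE /= big_cat big_map exprS mulrACA.
Qed.

Lemma count_fold_roots {F : numFieldType} (n : nat) (s : seq F) (z : F) :
  (0 < n)%N ->
  count_mem z (fold_roots n s) =
  (\sum_(i < n) count_mem (n%:R * z + i%:R)%R s)%N.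
Proof.
move=> n_gt0; have n0 : n%:R != 0 :> F by rewrite pnatr_eq0 -lt0n.
rewrite -(big_mkord xpredT (fun i => count_mem (n%:R * z + i%:R) s)).
rewrite /index_iota subn0 /fold_roots.
elim: (iota 0 n) => [|i r IH]; first by rewrite big_nil.
rewrite big_cons -IH /= count_cat count_map; congr (_ + _)%N.
apply: eq_count => w /=; apply/eqP/eqP => [<-|->]; by field.
Qed.

(** Equality on the positive integers is equality of polynomials, and the
    monic polynomials on the two sides have the same roots.  The scalar
    factors [n ^+ (n * size s)] and [n ^+ (n * size t)] agree by comparison of
    leading coefficients, whatever the sizes of [s] and [t]. *)
Lemma perm_fold_roots {F : numFieldType} (n : nat) (s t : seq F) :
  (0 < n)%N ->
  (forall k, (0 < k)%N ->
     (\prod_(i < n) \prod_(w <- s) (n%:R * k%:R + i%:R - w)) *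
       \prod_(w <- t) (k%:R - w) =
     (\prod_(i < n) \prod_(w <- t) (n%:R * k%:R + i%:R - w)) *
       \prod_(w <- s) (k%:R - w)) ->
  perm_eq (fold_roots n s ++ t) (fold_roots n t ++ s).
Proof.
move=> n_gt0 st; have n0 : n%:R != 0 :> F by rewrite pnatr_eq0 -lt0n.
pose p r : {poly F} := \prod_(w <- r) ('X - w%:P).
have pE r x : (p r).[x] = \prod_(w <- r) (x - w).
  by rewrite horner_prod; apply: eq_bigr => w _; rewrite hornerXsubC.
have cpE : n%:R ^+ (n * size s) *: p (fold_roots n s ++ t) =
           n%:R ^+ (n * size t) *: p (fold_roots n t ++ s).
  apply: poly_eq_on_posnat => k k_gt0; rewrite !hornerZ !pE !big_cat /= !mulrA.
  by rewrite -!prod_fold_roots// st.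
have lead r c : lead_coef (c *: p r) = c.
  by rewrite lead_coefZ (monicP (monic_prod_XsubC _ _ _)) mulr1.
apply: prod_XsubC_eq; have := congr1 lead_coef cpE; rewrite !lead => cE.
by move: cpE; rewrite cE; apply: scalerI; rewrite expf_neq0.
Qed.

(** * Telescoping the divisor *)

Definition posnat {F : numFieldType} (x : F) : bool :=
  `[< exists m : nat, x = m.+1%:R >].

(** The multiplicity of [z] as a zero of [\prod_(w <- s) 1 / Gamma(1 + w - z)],
    which is entire in [z] and whose zeros form the half-lines
    [w + {1, 2, ...}]. *)
Definition gamma_zeros {F : numFieldType} (s : seq F) (z : F) : nat :=
  count (fun w => posnat (z - w)) s.

(** Mirrors the functional equation of Gamma: passing from [z] to [z + 1]
    creates one zero for each occurrence of [z] in [s]. *)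
Lemma gamma_zerosS {F : numFieldType} (s : seq F) (z : F) :
  gamma_zeros s (z + 1) = (gamma_zeros s z + count_mem z s)%N.
Proof.
have natE (x : F) : posnat (x + 1) = (x == 0) || posnat x.
  apply/asboolP/orP => [[[|m] e]|[/eqP ->|/asboolP[m ->]]].
  - by left; apply/eqP; apply: (@addIr _ 1); rewrite e add0r.
  - by right; apply/asboolP; exists m; apply: (@addIr _ 1); rewrite e natr1.
  - by exists 0%N; rewrite add0r.
  - by exists m.+1; rewrite natr1.
have N0 : posnat (0 : F) = false.
  by apply/asboolP => -[m /esym/eqP]; rewrite pnatr_eq0.
elim: s => //= w s IH; rewrite /gamma_zeros /= -!/(gamma_zeros _ _) IH.
rewrite addrAC natE subr_eq0 (eq_sym z w); case: eqVneq => [->|_].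
  by rewrite subrr N0 /=; lia.
by rewrite /= add0n addnA.
Qed.

Lemma gamma_zeros_far {F : numFieldType} (s : seq F) (z : F) :
  exists K : nat, forall k, (K <= k)%N -> gamma_zeros s (z - k%:R) = 0%N.
Proof.
elim: s => [|w s [K HK]]; first by exists 0%N.
have [[m zw]|nzw] := pselect (exists m : nat, z - w = m%:R).
  exists (maxn K m) => k kK.
  rewrite /gamma_zeros /= -/(gamma_zeros _ _) HK; last by lia.
  rewrite addn0 /posnat; case: asboolP => // -[p] e; exfalso.
  have : (m%:R : F) = (p.+1 + k)%:R by rewrite natrD -e -zw; ring.
  by move/eqP; rewrite eqr_nat => /eqP; lia.
exists K => k kK; rewrite /gamma_zeros /= -/(gamma_zeros _ _) HK // addn0.
rewrite /posnat; case: asboolP => // -[p] e; case: nzw; exists (p.+1 + k)%N.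
by rewrite natrD -e; ring.
Qed.

Lemma gamma_zeros_mul {F : numFieldType} (s : seq F) (n : nat) (z : F) :
  gamma_zeros s (n%:R * (z + 1)) =
  (gamma_zeros s (n%:R * z)%R + \sum_(i < n) count_mem (n%:R * z + i%:R)%R s)%N.
Proof.
rewrite mulrDr mulr1; move: (n%:R * z) => y.
elim: n => [|m IH]; first by rewrite big_ord0 addr0 addn0.
by rewrite big_ord_recr /= addnA -IH -gamma_zerosS -natr1 addrA.
Qed.

Definition gamma_divisor {F : numFieldType} (s t : seq F) (z : F) : int :=
  (gamma_zeros s z)%:Z - (gamma_zeros t z)%:Z.

(** By the divisor equation the difference of the two sides has period 1 in
    [z], and it vanishes at [z - K] for large [K]. *)
Lemma gamma_divisor_scale {F : numFieldType} {n : nat} {s t : seq F} {z : F} :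
  (0 < n)%N ->
  perm_eq (fold_roots n s ++ t) (fold_roots n t ++ s) ->
  gamma_divisor s t (n%:R * z) = gamma_divisor s t z.
Proof.
move=> n_gt0 st.
pose g x : int := gamma_divisor s t (n%:R * x) - gamma_divisor s t x.
have gS x : g (x + 1) = g x.
  rewrite /g /gamma_divisor !gamma_zeros_mul !gamma_zerosS -!count_fold_roots//.
  have := congr1 Posz (permP st (pred1 x)); rewrite !count_cat !PoszD.
  by do 8 move: (Posz _) => ?; lia.
have gB k : g z = g (z - k%:R).
  elim: k => [|k ->]; first by rewrite subr0.
  by rewrite -[RHS]gS -natr1; congr g; ring.
have far (u : seq F) x : exists K : nat, forall k, (K <= k)%N ->
    gamma_zeros u (x - k%:R) = 0%N /\ gamma_zeros u (n%:R * (x - k%:R)) = 0%N.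
  have [K1 HK1] := gamma_zeros_far u x.
  have [K2 HK2] := gamma_zeros_far u (n%:R * x).
  exists (maxn K1 K2) => k kK; split; first by apply: HK1; lia.
  by rewrite mulrBr -natrM HK2//; nia.
have [K1 H1] := far s z; have [K2 H2] := far t z.
apply/eqP; rewrite -subr_eq0 -/(g z) (gB (maxn K1 K2)) /g /gamma_divisor.
have [-> ->] := H1 _ (leq_maxl K1 K2).
by have [-> ->] := H2 _ (leq_maxr K1 K2).
Qed.

(** A nonzero value at [z] propagates to every [z / n^k].  These are infinitely
    many points of norm at most [`|z|], all of the form [w + m] with [w] in one
    of the lists and [m > 0], which leaves finitely many choices of [m]. *)
Lemma gamma_divisor_eq0 {F : numFieldType} {n : nat} {s t : seq F} {z : F} :
  (forall x : F, exists m : nat, `|x| <= m%:R) ->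
  (1 < n)%N ->
  perm_eq (fold_roots n s ++ t) (fold_roots n t ++ s) ->
  z != 0 -> gamma_divisor s t z = 0.
Proof.
move=> archi n_gt1 st z0; apply/eqP/negP => /negP Gz.
have n0 : n%:R != 0 :> F by rewrite pnatr_eq0; lia.
have Gzk k : gamma_divisor s t (z / n%:R ^+ k) != 0.
  elim: k => [|k IH]; first by rewrite expr0 divr1.
  rewrite -(@gamma_divisor_scale _ n)//; last by lia.
  by rewrite exprS invfM mulrCA mulVKf.
have [B HB] : exists B : nat, forall w, w \in s ++ t -> `|z| + `|w| <= B%:R.
  elim: (s ++ t) => [|w r [B HB]]; first by exists 0%N.
  have [m1 Hm1] := archi z; have [m2 Hm2] := archi w.
  exists (B + m1 + m2)%N => x.
  rewrite inE => /predU1P[->|/HB /le_trans]; last first.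
    by apply; rewrite ler_nat; lia.
  by rewrite (le_trans (lerD Hm1 Hm2))// -natrD ler_nat; lia.
(* The points w + m of the half-lines that can have norm at most `|z|. *)
pose L := [seq w + m%:R | w <- s ++ t, m <- iota 0 B.+1].
have inL k : z / n%:R ^+ k \in L.
  have [w wst /asboolP[m zw]] :
      exists2 w, w \in s ++ t & posnat (z / n%:R ^+ k - w).
    apply/hasP; rewrite has_count count_cat; move: (Gzk k).
    by rewrite /gamma_divisor -/(gamma_zeros _ _) -/(gamma_zeros _ _); lia.
  apply/allpairsP; exists (w, m.+1); split; [by []| |by rewrite /= -zw; ring].
  rewrite mem_iota add0n leq0n /= ltnS -(ler_nat F) -(normr_nat F m.+1) -zw.
  rewrite (le_trans (ler_normB _ _))// (le_trans _ (HB _ wst))// lerD2r.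
  rewrite normrM normfV ler_piMr// invf_le1 ?normr_gt0 ?expf_neq0//.
  by rewrite normrX exprn_ege1// normr_nat ler1n; lia.
have: (size [seq z / n%:R ^+ k | k <- iota 0 (size L).+1] <= size L)%N.
  apply: uniq_leq_size => [|x /mapP[k _ ->]//].
  rewrite map_inj_uniq ?iota_uniq// => k l /(mulfI z0)/invr_inj.
  rewrite -!natrX => /eqP; rewrite eqr_nat => /eqP; exact: expnI.
by rewrite size_map size_iota ltnn.
Qed.

(** The conclusion says that [P/Q] is [((x+1)/x)^(m1-m2)], written without
    cancelling common roots of [P] and [Q].  The exponents are the two halves
    of [gamma_divisor s t 0]: with that function supported at 0, its increments
    are nonzero only at 0 and at -1. *)
Lemma root_lists_of_power {F : numFieldType} {n : nat} {s t : seq F} :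
  (forall x : F, exists m : nat, `|x| <= m%:R) ->
  (1 < n)%N ->
  perm_eq (fold_roots n s ++ t) (fold_roots n t ++ s) ->
  exists m1 m2 : nat, perm_eq (s ++ nseq m1 0 ++ nseq m2 (-1))
                              (t ++ nseq m1 (-1) ++ nseq m2 0).
Proof.
move=> archi n_gt1 st; exists (gamma_zeros s 0), (gamma_zeros t 0).
apply/allP => x _ /=; apply/eqP.
have := gamma_zerosS s x; have := gamma_zerosS t x.
rewrite !count_cat !count_nseq /=.
move: (count_mem x s) (count_mem x t) => cs ct.
have G0 (y : F) : y != 0 -> gamma_zeros s y = gamma_zeros t y.
  by move=> /(gamma_divisor_eq0 archi n_gt1 st); rewrite /gamma_divisor; lia.
have N10 : (-1 == 0 :> F) = false by rewrite oppr_eq0 oner_eq0.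
have [->|x0] := eqVneq x 0.
  by rewrite N10 add0r (G0 1) ?oner_eq0//; lia.
have [->|xN1] := eqVneq x (-1).
  by rewrite addNr (G0 (-1)) ?N10// => -> ->; lia.
by rewrite (G0 x)// (G0 (x + 1)) ?addr_eq0//; lia.
Qed.

(** Dividing [f(n(k+1)) = l f(k+1)] by [f(nk) = l f(k)] expresses the ratio of
    consecutive terms at [k] as the product of the ratios at [nk, ..., nk+n-1];
    this is the divisor equation.  The resulting form of the ratio makes
    [f(k)] proportional to [k^(m1-m2)]. *)
Lemma eigenvalue_is_power {F : numFieldType} (n : nat) (s t : seq F)
    (f : nat -> F) (l : F) :
  (forall x : F, exists m : nat, `|x| <= m%:R) ->
  (1 < n)%N ->
  (forall k, (0 < k)%N -> f k != 0) ->
  (forall k, (0 < k)%N -> \prod_(w <- t) (k%:R - w) != 0) ->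
  (forall k, (0 < k)%N -> f k.+1 * \prod_(w <- t) (k%:R - w) =
                          f k * \prod_(w <- s) (k%:R - w)) ->
  (forall k, (0 < k)%N -> f (n * k)%N = l * f k) ->
  exists i : int, l = n%:R ^ i.
Proof.
move=> archi n_gt1 f0 t0 fS fn.
have n_gt0 : (0 < n)%N by lia.
have l0 : l != 0.
  have := f0 (n * 1)%N; rewrite fn// muln1 => /(_ n_gt0).
  by rewrite mulf_eq0 negb_or => /andP[].
have nS : perm_eq (fold_roots n s ++ t) (fold_roots n t ++ s).
  apply: perm_fold_roots => // k k_gt0.
  have step m : f (n * k + m)%N *
      \prod_(i < m) \prod_(w <- t) (n%:R * k%:R + i%:R - w) =
      f (n * k)%N * \prod_(i < m) \prod_(w <- s) (n%:R * k%:R + i%:R - w).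
    elim: m => [|m IH]; first by rewrite !big_ord0 addn0.
    rewrite !big_ord_recr /= !mulrA -IH addnS -natrM -natrD.
    have nkm : (0 < n * k + m)%N by rewrite addn_gt0 muln_gt0 n_gt0 k_gt0.
    by rewrite mulrAC (fS _ nkm) mulrAC.
  have := step n; rewrite -mulnSr !fn// -!mulrA => /(mulfI l0) step1.
  apply: (mulfI (f0 k k_gt0)); rewrite mulrA -step1 mulrAC fS//; ring.
have [m1 [m2 st]] := root_lists_of_power archi n_gt1 nS.
have stE x : \prod_(w <- s) (x - w) * (x ^+ m1 * (x + 1) ^+ m2) =
             \prod_(w <- t) (x - w) * ((x + 1) ^+ m1 * x ^+ m2).
  have : \prod_(w <- s ++ nseq m1 0 ++ nseq m2 (-1)) (x - w) =
         \prod_(w <- t ++ nseq m1 (-1) ++ nseq m2 0) (x - w).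
    exact: perm_big.
  by rewrite !big_cat !big_nseq !iter_mulr_1 subr0 opprK.
have fE k : (0 < k)%N -> f k * k%:R ^+ m2 = f 1%N * k%:R ^+ m1.
  elim: k => // -[|k] IH _; first by rewrite !expr1n.
  have k0 : k.+1%:R != 0 :> F by rewrite pnatr_eq0.
  have := stE k.+1%:R; have := fS k.+1 isT; have := t0 k.+1 isT.
  have {IH} := IH isT; rewrite natr1.
  move: (\prod_(w <- s) _) (\prod_(w <- t) _) (f k.+1) (f k.+2) => S T y z.
  move=> IH T0 zE ST.
  apply: (mulIf (mulf_neq0 T0 (mulf_neq0 (expf_neq0 m1 k0) (expf_neq0 m2 k0)))).
  transitivity (z * T * (k.+1%:R ^+ m1 * k.+2%:R ^+ m2) * k.+1%:R ^+ m2).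
    by ring.
  rewrite zE -(mulrA y) ST.
  transitivity (y * k.+1%:R ^+ m2 * T * k.+2%:R ^+ m1 * k.+1%:R ^+ m2).
    by ring.
  by rewrite IH; ring.
exists (m1%:Z - m2%:Z).
have n0 : n%:R != 0 :> F by rewrite pnatr_eq0; lia.
rewrite expfzDr// -exprnN -exprnP; apply: (mulIf (expf_neq0 m2 n0)).
rewrite divfK ?expf_neq0//; apply: (mulIf (f0 1%N isT)).
by rewrite mulrAC -fn// muln1 fE// mulrC.
Qed.

(** * Coefficients of hypergeometric series *)

Lemma ascfactS {F : fieldType} (c : F) (k : nat) :
  ascfact c k.+1 = ascfact c k * (c + k%:R).
Proof. by rewrite /ascfact big_ord_recr. Qed.

Lemma addr_nat_neq0 {F : fieldType} (c : F) (k : nat) :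
  ~ nonpos_integer c -> c + k%:R != 0.
Proof.
move=> nc; apply/eqP => /eqP; rewrite addr_eq0 => /eqP ck.
by apply: nc; exists k.
Qed.

Lemma ascfact_neq0 {F : fieldType} (c : F) (k : nat) :
  ~ nonpos_integer c -> ascfact c k != 0.
Proof. by move=> nc; apply/prodf_neq0 => i _; exact: addr_nat_neq0. Qed.

(** A parameter [c] contributes the factor [c + k] to the ratio of the terms
    [k + 1] and [k] of the sum.  After multiplication by [x] that ratio sits at
    index [k + 1], where the factor is [(k + 1) - (1 - c)]. *)
Definition param_roots {F : fieldType} (a : seq F) : seq F :=
  [seq 1 - c | c <- a].

Lemma prod_param_roots {F : fieldType} (a : seq F) (k : nat) :
  \prod_(w <- param_roots a) (k.+1%:R - w) = \prod_(c <- a) (c + k%:R).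
Proof.
by rewrite big_map; apply: eq_bigr => c _; rewrite -natr1; ring.
Qed.

Lemma prod_seq_neq0 {F : fieldType} {I : eqType} (r : seq I) (g : I -> F) :
  (forall i, i \in r -> g i != 0) -> \prod_(i <- r) g i != 0.
Proof. by move=> g0; rewrite prodf_seq_neq0; apply/allP => i /g0. Qed.

Lemma hyp_series_neq0 {F : numFieldType} (a b : seq F) (k : nat) :
  (forall c, c \in a -> ~ nonpos_integer c) ->
  (forall c, c \in b -> ~ nonpos_integer c) ->
  hyp_series a b k != 0.
Proof.
move=> ha hb; rewrite /hyp_series.
rewrite !mulf_neq0 ?invr_eq0 ?pnatr_eq0 -?lt0n ?fact_gt0 //.
  by apply: prod_seq_neq0 => c /ha; exact: ascfact_neq0.
by apply: prod_seq_neq0 => c /hb; exact: ascfact_neq0.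
Qed.

(** The extra root 0 in the denominator comes from the factor [1 / k!]. *)
Lemma hyp_seriesS {F : numFieldType} (a b : seq F) (k : nat) :
  (forall c, c \in b -> ~ nonpos_integer c) ->
  hyp_series a b k.+1 * \prod_(w <- 0 :: param_roots b) (k.+1%:R - w) =
  hyp_series a b k * \prod_(w <- param_roots a) (k.+1%:R - w).
Proof.
move=> hb; rewrite big_cons !prod_param_roots subr0 /hyp_series factS natrM.
under eq_bigr do rewrite ascfactS.
under [X in _ / X / _]eq_bigr do rewrite ascfactS.
rewrite !big_split /=.
have B0 : \prod_(c <- b) ascfact c k != 0.
  by apply: prod_seq_neq0 => c /hb; exact: ascfact_neq0.
have B1 : \prod_(c <- b) (c + k%:R) != 0.
  by apply: prod_seq_neq0 => c /hb; exact: addr_nat_neq0.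
have k0 : k.+1%:R != 0 :> F by rewrite pnatr_eq0.
have kf0 : k`!%:R != 0 :> F by rewrite pnatr_eq0 -lt0n fact_gt0.
move: B0 B1 k0 kf0.
set B := \prod_(c <- b) ascfact c k; set D := \prod_(c <- b) (c + k%:R).
set A := \prod_(c <- a) ascfact c k; set C := \prod_(c <- a) (c + k%:R).
move: A B C D (k.+1%:R) (k`!%:R) => A B C D K f *.
by field; do ?[apply/andP; split].
Qed.

Lemma ascfact1 {F : fieldType} (k : nat) : ascfact (1 : F) k = k`!%:R.
Proof.
elim: k => [|k IH]; first by rewrite /ascfact big_ord0.
by rewrite ascfactS IH nat1r -natrM mulnC -factS.
Qed.

Lemma ascfact2 {F : fieldType} (k : nat) : ascfact (2 : F) k = k.+1`!%:R.
Proof.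
elim: k => [|k IH]; first by rewrite /ascfact big_ord0.
by rewrite ascfactS IH -natrD -natrM mulnC -factS.
Qed.

(** [(2)_k / (1)_k = k + 1]; the leading parameter 1 cancels [k!]. *)
Lemma hyp_series_power {F : numFieldType} (p q k : nat) :
  hyp_series (1 :: nseq p 2 ++ nseq q 1) (nseq p 1 ++ nseq q 2) k =
  k.+1%:R ^+ p / k.+1%:R ^+ q :> F.
Proof.
rewrite /hyp_series big_cons !big_cat !big_nseq !iter_mulr_1 ascfact1.
rewrite ascfact2 /=.
have k0 : k.+1%:R != 0 :> F by rewrite pnatr_eq0.
have kf0 : k`!%:R != 0 :> F by rewrite pnatr_eq0 -lt0n fact_gt0.
have kfX r : k`!%:R ^+ r != 0 :> F by rewrite expf_neq0.
have kX : k.+1%:R ^+ q != 0 :> F by rewrite expf_neq0.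
rewrite factS natrM !exprMn; move: kf0 (kfX p) (kfX q) kX.
move: (k`!%:R) (_ ^+ p) (_ ^+ q) (_ ^+ p) (_ ^+ q) => *; field.
by do ?[apply/andP; split].
Qed.

(** * The eigenvalues *)

(** The value at index 0 is set apart because [0 ^ 0 = 1]. *)
Definition power_fps {F : fieldType} (i : int) : fps F :=
  fun k => if k == 0%N then 0 else k%:R ^ i.

Lemma hypergeometric_power_fps {F : numFieldType} (i : int) :
  hypergeometric F (power_fps i).
Proof.
have [p [q iE]] : exists p q : nat, i = p%:Z - q%:Z.
  by case: i => m; [exists m, 0%N | exists 0%N, m.+1]; lia.
have pos m : m.+1%:R != 0 :> F /\ ~ nonpos_integer (m.+1%:R : F).
  rewrite pnatr_eq0; split=> // -[r /eqP].
  by rewrite -addr_eq0 -natrD pnatr_eq0.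
have [pos1 pos2] := (pos 0%N, pos 1%N).
exists 1, 1%N, (1 :: nseq p 2 ++ nseq q 1), (nseq p 1 ++ nseq q 2).
split; first exact: oner_neq0.
- move=> c; rewrite inE mem_cat !mem_nseq.
  by case/or3P => [|/andP[_]|/andP[_]] /eqP ->.
- by move=> c; rewrite mem_cat !mem_nseq => /orP[] /andP[_] /eqP ->.
apply: funext => -[|k]; rewrite /power_fps /fps_scale /fps_shift ?mulr0//=.
have k0 : k.+1%:R != 0 :> F by rewrite pnatr_eq0.
by rewrite subSS subn0 hyp_series_power mul1r iE expfzDr// -exprnN.
Qed.

Lemma U_power_fps {F : numFieldType} (n : nat) (i : int) : (0 < n)%N ->
  U n (power_fps i) = fps_scale (n%:R ^ i) (power_fps i : fps F).
Proof.
move=> n_gt0; apply: funext => k; rewrite /U /power_fps /fps_scale.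
rewrite muln_eq0 eqn0Ngt n_gt0 /=; case: eqP => _; first by rewrite mulr0.
by rewrite natrM expfzMl.
Qed.

(** The support of [f] is [{k | j <= k}] and that of [U n f] is
    [{k | j <= n * k}]; for [n > 1] they differ at [j - 1] unless [j <= 1]. *)
Lemma hypergeometric_eigenvalue {F : numFieldType} (n : nat) (f : fps F)
    (l : F) :
  (forall x : F, exists m : nat, `|x| <= m%:R) ->
  (0 < n)%N -> hypergeometric F f -> U n f = fps_scale l f ->
  exists i : int, l = n%:R ^ i.
Proof.
move=> archi n_gt0 [a0 [j [a [b [a00 ha hb fE]]]]] Uf.
have fn k : f (n * k)%N = l * f k by exact: (congr1 (fun g => g k) Uf).
have h0 k : hyp_series a b k != 0.
  by apply: hyp_series_neq0 => c; [case/ha|case/hb].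
have fk0 k : (f k != 0) = (j <= k)%N.
  rewrite fE /fps_scale /fps_shift ltnNge; case: leqP => _ /=.
    by rewrite mulf_neq0.
  by rewrite mulr0 eqxx.
have [n1|n1] := eqVneq n 1%N.
  exists 0; apply: (@mulIf _ (f j)); first by rewrite fk0.
  by rewrite expr0z mul1r -fn n1 mul1n.
have n_gt1 : (1 < n)%N by lia.
have l0 : l != 0.
  have : l * f j != 0 by rewrite -fn fk0 leq_pmull.
  by rewrite mulf_eq0 negb_or => /andP[].
have j_le1 : (j <= 1)%N.
  have := fk0 (n * j.-1)%N.
  by rewrite fn mulf_eq0 (negPf l0) fk0; nia.
case: j j_le1 fE fk0 => [|[|//]] _ fE fk0.
  exists 0; apply: (@mulIf _ (f 0%N)); first by rewrite fk0.
  by rewrite expr0z mul1r -fn muln0.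
have fS k : f k.+1 = a0 * hyp_series a b k.
  by rewrite fE /fps_scale /fps_shift subSS subn0.
apply: (@eigenvalue_is_power _ n (param_roots a) (0 :: param_roots b) f) => //.
- by move=> k; rewrite fk0.
- move=> [//|k] _; rewrite big_cons prod_param_roots subr0.
  rewrite mulf_neq0 ?pnatr_eq0//.
  by apply: prod_seq_neq0 => c /hb[_]; exact: addr_nat_neq0.
- move=> [//|k] _; rewrite !fS -[LHS]mulrA -[RHS]mulrA.
  by rewrite hyp_seriesS// => c /hb[].
Qed.

Lemma complex_archimedean {R : realType} (x : R[i]) :
  exists m : nat, `|x| <= m%:R.
Proof.
case: x => x y; rewrite normc_def /=.
exists (Num.bound (Num.sqrt (x ^+ 2 + y ^+ 2))).
rewrite -(rmorph_nat (@real_complex R)) lecR.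
by apply/ltW/archi_boundP; exact: sqrtr_ge0.
Qed.

Theorem theorem6p15 (R : realType) (n : nat) (hn : (1 <= n)%N) :
  spectrum (@U R[i] n) (hypergeometric R[i]) =
  [set (n%:R : R[i]) ^ i | i in [set: int]].
Proof.
apply/seteqP; split=> l /=.
  move=> [f hf Uf].
  have [i ->] := hypergeometric_eigenvalue _ _ _ complex_archimedean hn hf Uf.
  by exists i.
move=> [i _ <-]; exists (power_fps i); first exact: hypergeometric_power_fps.
exact: U_power_fps.
Qed.
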